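(* There is a function $\eta:\mathbb N_{\ge1}\to(0,\infty)$ (independent of $n$) with $\eta(L)\to0$ as $L\to\infty$ such that the following holds. Let $\delta>0$ and $L\in\mathbb N_{\ge1}$ be fixed constants, and let $W$ be any Bernoulli-reducible memoryless channel with continuous input and discrete output. Let $E(n)>0$ be any sequence with $nE(n)\to\infty$ and $E(n)<\frac{1}{\delta\log n}$ for all $n\geq 2$. Then, for all sufficiently large $n$, there exists an $(n,N^{(n)},L2^{-nE(n)},2^{-nE(n)})$ deterministic identification code for $W$ whose linear-scale rate $R(n)=\frac1n\log N^{(n)}$ satisfies $$R(n)\ \ge\ \frac{1-\eta(L)}{2}\,\log\left(\frac{1}{E(n)}-\delta\log n\right)-O(1),$$ where the $O(1)$ term is bounded as $n\to\infty$ (for fixed $\delta$, $L$, $W$).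
   Context: Logarithms $\log$ are to base 2. A channel $W:\mathcal X\to\mathcal Y$ assigns to each $x\in\mathcal X$ a probability measure $W(\cdot|x)$ on $\mathcal Y$ (here $\mathcal Y$ is discrete). Channels are memoryless: on input $x^n=(x_1,\dots,x_n)$ the output $Y^n$ has independent coordinates with $Y_i\sim W(\cdot|x_i)$; its law is $W^n(\cdot|x^n)$. $W$ is Bernoulli-reducible if its image $\{W(\cdot|x):x\in\mathcal X\}$ contains a non-trivial continuous curve, i.e. the image of a non-constant map from $[0,1]$ into the probability measures on $\mathcal Y$ that is continuous in total variation distance. An $(n,N,\lambda_1,\lambda_2)$ deterministic identification (DI) code for $W$ is a family $\{(u_i,\mathcal D_i): i\in[N]\}$ with $u_i\in\mathcal X^n$ and $\mathcal D_i\subset\mathcal Y^n$ (regions may overlap) such that for all distinct $i,j\in[N]$: $W^n(\mathcal D_i|u_i)\ge 1-\lambda_1$ and $W^n(\mathcal D_j|u_i)\le\lambda_2$. *)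

(* Defs.v *)
From HB Require Import structures.
From mathcomp Require Import all_boot all_order all_algebra.
From mathcomp Require Import all_classical all_reals all_analysis.

Set Implicit Arguments.
Unset Strict Implicit.
Unset Printing Implicit Defensive.

Import Order.TTheory GRing.Theory Num.Theory.
Import numFieldNormedType.Exports.

Local Open Scope classical_set_scope.
Local Open Scope ring_scope.

Definition log2 (R : realType) (x : R) : R := ln x / ln 2.

Definition discrete_space (d : measure_display) (Y : measurableType d) : Prop :=
  countable [set: Y] /\ forall A : set Y, measurable A.

(* A channel with input alphabet [X] and output alphabet [Y] is a map
   [W : X -> probability Y R]; no structure on [X] is needed. *)

(* [P] and [Q] are finite, so [fine] loses nothing, and the set below is
   nonempty and bounded by 1, so [sup] is a genuine supremum. *)
Definition tv_dist (R : realType) (d : measure_display) (Y : measurableType d)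
    (P Q : probability Y R) : R :=
  sup [set `|fine (P A) - fine (Q A)| | A in @measurable d Y].

(* Measures are compared as set functions ([=1]), so that equality does not
   depend on the proofs bundled in the type [probability Y R]. *)
Definition Bernoulli_reducible (R : realType) (X : Type) (d : measure_display)
    (Y : measurableType d) (W : X -> probability Y R) : Prop :=
  exists gamma : R -> probability Y R,
    [/\ forall t : R, 0 <= t <= 1 ->
          tv_dist (gamma s) (gamma t) @[s --> within `[0, 1] (nbhs t)] --> 0,
        exists s t : R, [/\ 0 <= s <= 1, 0 <= t <= 1 & ~ (gamma s =1 gamma t)] &
        forall t : R, 0 <= t <= 1 -> exists x, W x =1 gamma t].

(* [W^n(A | x^n)], for a countable discrete output alphabet: the law of a vector
   with independent coordinates [Y_i ~ W(.|x_i)] has the product mass function. *)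
Definition channel_pow (R : realType) (X : Type) (d : measure_display)
    (Y : measurableType d) (W : X -> probability Y R) (n : nat)
    (x : n.-tuple X) (A : set (n.-tuple Y)) : \bar R :=
  (\esum_(y in A) \prod_(i < n) W (tnth x i) [set tnth y i])%E.

Definition DI_code (R : realType) (X : Type) (d : measure_display)
    (Y : measurableType d) (W : X -> probability Y R) (n N : nat)
    (lambda1 lambda2 : R)
    (u : 'I_N -> n.-tuple X) (D : 'I_N -> set (n.-tuple Y)) : Prop :=
  forall i j : 'I_N, i != j ->
    ((1 - lambda1)%:E <= channel_pow W (u i) (D i))%E /\
    (channel_pow W (u i) (D j) <= lambda2%:E)%E.

(* Main.v *)
(** Fix an event [A] of the output alphabet whose probability under the inputs
    covers an interval [[a, b]], so that a codeword becomes a vector [P] in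
    [[a, b]^n] observed through [1_A(y_i)].  A codeword is written with [L]
    digits per letter, [P_i = a + h * x_i] with [x_i = \sum_(j < L) s_(j,i) B^j];
    each digit string [s_j] lies in a Gilbert--Varshamov code of relative
    distance [1/(L+1)], and by pigeonhole all truncations
    [r_k = \sum_(j < k) s_j B^j] have norms independent of the codeword.  The
    decision region of a codeword asks, for each [k = 1, ..., L], that the
    correlation of [r_k] with the output is not much below its mean.  If [j] is
    the top digit where two codewords [x], [x'] differ, then for [k = j+1]
    [<r_k, x' - x> = <r_k, r'_k - r_k> = - |r'_k - r_k|^2 / 2],
    of order [n B^(2j) / L], whereas the fluctuations allowed by a Chernoff bound
    with error [exp(-nE)] are of order [n sqrt(E) B^(j+1) / h].  All [L] tests
    work as soon as [B^(L+1) sqrt(E)] is below a constant, which allows about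
    [B^L = E^(-L/(2(L+1)))] letters: hence the factor [1/2], and
    [eta(L) = 2/(L+1)] once the loss of the outer codes is included. *)

Require Import Defs.
From HB Require Import structures.
From mathcomp Require Import all_boot all_order all_algebra.
From mathcomp Require Import all_classical all_reals all_analysis.
From mathcomp Require Import zify ring lra.

Import Order.TTheory GRing.Theory Num.Theory.
Import numFieldNormedType.Exports.

Set Implicit Arguments.
Unset Strict Implicit.
Unset Printing Implicit Defensive.

(** * Hamming balls, Gilbert--Varshamov codes and the pigeonhole principle *)

Definition hamming (T : eqType) (n : nat) (x y : {ffun 'I_n -> T}) : nat :=
  #|[set i | x i != y i]|.

Lemma leq_card_bigcup (I T : finType) (P : pred I) (F : I -> {set T}) :
  #|\bigcup_(i | P i) F i| <= \sum_(i | P i) #|F i|.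
Proof.
elim/big_rec2: _ => [|i m A _ IH]; first by rewrite cards0.
by apply: leq_trans (leq_card_setU _ _) _; rewrite leq_add2l.
Qed.

(** A word of the ball is determined by the set of positions where it leaves [x], one of at most
    [2 ^ n], and by its letters there. The crude factor [2 ^ n] costs one bit per channel use for
    each digit, a bounded loss of rate. *)
Lemma card_hamming_ball (T : finType) (n d : nat) (x : {ffun 'I_n -> T}) :
  0 < #|T| -> #|[set y | hamming x y <= d]| <= 2 ^ n * #|T| ^ d.
Proof.
move=> T_gt0; have /card_gt0P[x0 _] := T_gt0.
pose agree (S : {set 'I_n}) := [set y : {ffun 'I_n -> T} | [set i | x i != y i] \subset S].
have card_agree S : #|agree S| <= #|T| ^ #|S|.
  (* Outside [S] a word of [agree S] equals [x], so overwriting it there with [x0] loses nothing. *)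
  pose g (y : {ffun 'I_n -> T}) := [ffun i => if i \in S then y i else x0].
  have injg : {in agree S &, injective g}.
    move=> y z; rewrite !inE => /fintype.subsetP yS /fintype.subsetP zS /ffunP eg.
    apply/ffunP=> i; have := eg i; rewrite !ffunE; case: ifP => // iS _.
    have := yS i; have := zS i; rewrite !inE iS.
    by case: eqP => [<- _|_ /(_ isT)//]; case: eqP => [<-|_ /(_ isT)].
  rewrite -(card_in_imset injg) -(card_pffun_on x0 S (predT : pred T)).
  apply: subset_leq_card; apply/fintype.subsetP => _ /imsetP[y _ ->].
  by apply/pffun_onP; split=> // ; apply/fintype.subsetP => i; rewrite !inE ffunE;
     case: ifP => //; rewrite eqxx.
have sub : [set y | hamming x y <= d] \subset
    \bigcup_(S in [set S : {set 'I_n} | #|S| <= d]) agree S.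
  apply/fintype.subsetP => y; rewrite inE => xy; apply/bigcupP.
  by exists [set i | x i != y i]; rewrite ?inE.
apply: leq_trans (subset_leq_card sub) _.
apply: leq_trans (leq_card_bigcup _ _) _.
apply: (@leq_trans (\sum_(S in [set S : {set 'I_n} | #|S| <= d]) #|T| ^ d)).
  apply: leq_sum => S; rewrite inE => Sd.
  by apply: leq_trans (card_agree S) _; rewrite leq_pexp2l.
rewrite sum_nat_const leq_mul2r; apply/orP; right.
by apply: leq_trans (max_card _) _; rewrite -cardsT -powersetT card_powerset cardsT card_ord.
Qed.

(* Gilbert--Varshamov: the balls around a code of maximal size cover the space. *)
Lemma gilbert_varshamov (T : finType) (n d : nat) :
  0 < #|T| ->
  exists C : {set {ffun 'I_n -> T}},
    (forall x y, x \in C -> y \in C -> x != y -> d < hamming x y) /\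
    #|T| ^ n <= #|C| * (2 ^ n * #|T| ^ d).
Proof.
move=> T_gt0.
pose P (C : {set {ffun 'I_n -> T}}) :=
  [forall x in C, forall y in C, (x != y) ==> (d < hamming x y)].
have P0 : P finset.set0 by apply/forall_inP => x; rewrite inE.
case: (@arg_maxnP _ _ P (fun C => #|C|) P0) => C /forall_inP PC maxC.
exists C; split=> [x y xC yC xy|].
  by have /forall_inP/(_ y yC)/implyP := PC x xC; apply.
have hammingC x y : hamming x y = hamming y x.
  by apply: eq_card => i; rewrite !inE eq_sym.
have cov : [set: {ffun 'I_n -> T}] \subset \bigcup_(x in C) [set y | hamming x y <= d].
  apply/fintype.subsetP => y _; apply/bigcupP; apply/exists_inP.
  apply: contraT; rewrite negb_exists_in => /forall_inP yC.
  have {}yC x : x \in C -> d < hamming x y by move=> /yC; rewrite inE -ltnNge.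
  have y_notin : y \notin C.
    apply/negP => /yC; rewrite /hamming (_ : [set i | _] = finset.set0) ?cards0//.
    by apply/setP => i; rewrite !inE eqxx.
  have : P (y |: C).
    apply/forall_inP => u; rewrite !inE => /orP[/eqP->|uC];
      apply/forall_inP => v; rewrite !inE => /orP[/eqP->|vC]; apply/implyP.
    - by rewrite eqxx.
    - by move=> _; rewrite hammingC yC.
    - by move=> _; rewrite yC.
    - by have /forall_inP/(_ v vC)/implyP := PC u uC.
  by move=> /maxC /=; rewrite cardsU1 y_notin add1n ltnn.
have := subset_leq_card cov; rewrite cardsT card_ffun card_ord => /leq_trans; apply.
apply: leq_trans (leq_card_bigcup _ _) _.
apply: (@leq_trans (\sum_(x in C) 2 ^ n * #|T| ^ d)); last by rewrite sum_nat_const.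
by apply: leq_sum => x _; exact: card_hamming_ball.
Qed.

Lemma pigeonhole (T V : finType) (A : {set T}) (f : T -> V) :
  0 < #|V| -> exists v, #|A| <= #|[set x in A | f x == v]| * #|V|.
Proof.
move=> /card_gt0P[v0 _]; pose F v := #|[set x in A | f x == v]|.
case: (@arg_maxnP _ v0 xpredT F isT) => v _ maxv; exists v.
rewrite -sum1_card (partition_big f predT)//=.
apply: (@leq_trans (\sum_(w : V) F v)); last by rewrite sum_nat_const mulnC.
by apply: leq_sum => w _; apply: leq_trans (maxv w isT); rewrite /F -sum1_card;
   apply: eq_leq; apply: eq_bigl => x; rewrite inE.
Qed.

(** * Multilevel codewords and their truncations *)

Section Digits.
Variables (n M L : nat).
Implicit Types s t : {ffun 'I_L.+1 -> {ffun 'I_n -> 'I_M}}.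

(* Digits below [M] in base [2 * M]: two codewords with different digits at
   position [k] stay apart whatever their lower digits are. [inord] only serves
   to index the digits by [nat]; it is meaningful for [k <= L]. *)
Definition residue s (k : nat) (i : 'I_n) : nat :=
  \sum_(j < k) s (inord j) i * (2 * M) ^ j.

Lemma residueS s k i : residue s k.+1 i = residue s k i + s (inord k) i * (2 * M) ^ k.
Proof. by rewrite /residue big_ord_recr. Qed.

Lemma residue_lt s k i : 2 * residue s k i < (2 * M) ^ k.
Proof.
elim: k => [|k IH]; first by rewrite /residue big_ord0.
rewrite residueS expnS.
have := ltn_ord (s (inord k) i); move: IH; set X := _ ^ k; nia.
Qed.

(** The digits at position [k] differ by at least one unit [(2 * M) ^ k], and each lower part is
    below half a unit. Of the two truncated differences one is zero, so they add up to the absolute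
    difference. *)
Lemma residue_dist s t k i : s (inord k) i != t (inord k) i ->
  (2 * M) ^ k <= 2 * (residue s k.+1 i - residue t k.+1 i)
               + 2 * (residue t k.+1 i - residue s k.+1 i).
Proof.
rewrite -val_eqE /= !residueS; have := residue_lt s k i; have := residue_lt t k i.
set X := _ ^ k; move: (residue s k i) (residue t k i) (nat_of_ord _) (nat_of_ord _).
move=> a b x y bX aX; case: (ltngtP x y) => // xy _.
  have : x.+1 * X <= y * X by rewrite leq_mul2r xy orbT.
  by rewrite mulSn; move: (x * X) (y * X) => p q; lia.
have : y.+1 * X <= x * X by rewrite leq_mul2r xy orbT.
by rewrite mulSn; move: (x * X) (y * X) => p q; lia.
Qed.

(** From position [k] on, both words gain the same amount; the additive form avoids the truncated
    subtraction of [nat]. *)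
Lemma residue_eq s t k i :
  (forall j : 'I_L.+1, k <= j -> s j = t j) ->
  forall m, k <= m <= L.+1 -> residue s m i + residue t k i = residue t m i + residue s k i.
Proof.
move=> st; elim=> [|m IH]; first by rewrite leqn0 addnC => /andP[/eqP->].
case: (ltngtP k m.+1) => //= [km mL|<- _]; last by rewrite addnC.
rewrite !residueS st; last by rewrite inordK.
have := IH; rewrite -ltnS km (ltnW mL) => /(_ isT); lia.
Qed.

(** Each digit runs over a Gilbert--Varshamov code, and a pigeonhole on the vector of the [L.+1]
    squared norms keeps one class. Each norm takes at most [n * (2 * M) ^ (2 * L.+1)] values, hence
    the last factor of the count. *)
Lemma multilevel_code (d : nat) : 0 < M -> 0 < n ->
  exists (N : nat) (r : 'I_N -> nat -> 'I_n -> nat),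
  [/\ 0 < N,
      forall a k i, 2 * r a k i < (2 * M) ^ k,
      forall a b, a != b -> exists k, [/\ k < L.+1,
        forall i, r a L.+1 i + r b k.+1 i = r b L.+1 i + r a k.+1 i,
        \sum_i r a k.+1 i ^ 2 = \sum_i r b k.+1 i ^ 2 &
        d < #|[set i | (2 * M) ^ k <= 2 * (r a k.+1 i - r b k.+1 i)
                                    + 2 * (r b k.+1 i - r a k.+1 i)]|] &
      M ^ (n * L.+1) <=
        N * (2 ^ n * M ^ d) ^ L.+1 * (n * (2 * M) ^ (2 * L.+1)) ^ L.+1].
Proof.
move=> M_gt0 n_gt0.
have [|C [Cd cardC]] := @gilbert_varshamov 'I_M n d; first by rewrite card_ord.
rewrite card_ord in cardC.
pose A := [set s : {ffun 'I_L.+1 -> {ffun 'I_n -> 'I_M}} | s \in ffun_on C].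
have cardA : #|A| = #|C| ^ L.+1.
  by rewrite cardsE card_ffun_on card_ord.
pose K := n * (2 * M) ^ (2 * L.+1).
have K_gt0 : 0 < K by rewrite muln_gt0 n_gt0 expn_gt0 muln_gt0 M_gt0.
pose norm s k := \sum_i residue s k i ^ 2.
have normK s k : k <= L.+1 -> norm s k < K.
  move=> kL; rewrite /norm; apply: (@leq_ltn_trans (\sum_(i < n) ((2 * M) ^ (2 * L.+1)).-1)).
    apply: leq_sum => i _; rewrite -ltnS prednK ?expn_gt0 ?muln_gt0 ?M_gt0//.
    rewrite [2 * L.+1]mulnC expnM ltn_exp2r//.
    apply: (@leq_trans ((2 * M) ^ k)); last by rewrite leq_pexp2l ?muln_gt0 ?M_gt0.
    by have := residue_lt s k i; lia.
  rewrite sum_nat_const card_ord ltn_mul2l n_gt0/= ltn_predL expn_gt0 muln_gt0 M_gt0//.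
(* Reduction modulo [K] only produces an element of ['I_K]; by [normK] it changes no norm. *)
pose f s : {ffun 'I_L.+1 -> 'I_K} := [ffun k : 'I_L.+1 => Ordinal (ltn_pmod (norm s k.+1) K_gt0)].
have [|v cardS] := pigeonhole A f.
  by rewrite card_ffun !card_ord expn_gt0 K_gt0.
set S := [set x in A | f x == v] in cardS.
rewrite card_ffun !card_ord cardA in cardS.
have cardCL : M ^ (n * L.+1) <= #|C| ^ L.+1 * (2 ^ n * M ^ d) ^ L.+1.
  by rewrite expnM -expnMn leq_exp2r.
have C_gt0 : 0 < #|C|.
  by move: cardC; case: (#|C|) => //; rewrite mul0n leqn0 expn_eq0; lia.
exists #|S|, (fun a => residue (enum_val a)); split.
- by move: cardS; case: (#|S|) => //; rewrite mul0n leqn0 expn_eq0; lia.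
- by move=> a k i; exact: residue_lt.
- move=> a b ab; set s := enum_val a; set t := enum_val b.
  have sS : s \in S := enum_valP a.
  have tS : t \in S := enum_valP b.
  have st : s != t by apply: contraNneq ab => /enum_val_inj ->.
  have [j0 j0P] : exists j, s j != t j.
    by apply/existsP; apply: contraNT st => /existsPn st; apply/eqP/ffunP => j; apply/eqP; rewrite -[_ == _]negbK.
  (* [j] is the highest position at which the two digit strings differ. *)
  case: (@arg_maxnP _ j0 (fun j => s j != t j) val j0P) => j sj maxj.
  exists j; split => //.
  + move=> i; apply: residue_eq => [l jl|]; last by rewrite ltn_ord leqnn.
    by apply/eqP; apply: contraTT jl => /maxj /=; rewrite -ltnNge ltnS.
  + move: sS tS; rewrite !inE => /andP[_ /eqP sv] /andP[_ /eqP tv].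
    have := congr1 val (congr1 (fun g : {ffun 'I_L.+1 -> 'I_K} => g j) (etrans sv (esym tv))).
    by rewrite !ffunE /= !modn_small// normK.
  + have sC : s j \in C by move: sS; rewrite !inE => /andP[/ffun_onP].
    have tC : t j \in C by move: tS; rewrite !inE => /andP[/ffun_onP].
    apply: leq_trans (Cd _ _ sC tC sj) _.
    apply/subset_leq_card/fintype.subsetP => i; rewrite !inE => stj.
    by apply: residue_dist; rewrite inord_val.
- apply: leq_trans cardCL _.
  by rewrite mulnAC leq_mul2r cardS orbT.
Qed.
End Digits.

Local Open Scope classical_set_scope.
Local Open Scope ring_scope.

(** * Sums over countable alphabets and product mass functions *)

Section Esum.
Local Open Scope ereal_scope.
Context {R : realType}.

Lemma esumZl (T : choiceType) (S : set T) (c : R) (f : T -> \bar R) :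
  (0 <= c)%R -> (forall i, 0 <= f i) ->
  \esum_(i in S) (c%:E * f i) = c%:E * \esum_(i in S) f i.
Proof.
have le (b : R) (g : T -> \bar R) : (0 <= b)%R -> (forall i, 0 <= g i) ->
    \esum_(i in S) (b%:E * g i) <= b%:E * \esum_(i in S) g i.
  move=> b0 g0; apply: ge_ereal_sup => /= _ [X [finX XS] <-].
  rewrite -ge0_mule_fsumr//; apply: lee_wpmul2l; first by rewrite lee_fin.
  by apply: ereal_sup_ubound; exists X.
move=> c0 f0; apply/eqP; rewrite eq_le le//=.
have [->|c_neq0] := eqVneq c 0%R.
  by rewrite mul0e; apply: esum_ge0 => i _; rewrite mul0e.
have c_gt0 : (0 < c)%R by rewrite lt_neqAle eq_sym c_neq0.
have := le c^-1%R (fun i => c%:E * f i); rewrite invr_ge0 => /(_ c0).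
have cf0 i : 0 <= c%:E * f i by rewrite mule_ge0 ?lee_fin.
move=> /(_ cf0).
under eq_esum do rewrite muleA -EFinM mulVf// mul1e.
move=> fcf.
have : c%:E * (\esum_(i in S) f i) <= c%:E * (c^-1%:E * (\esum_(i in S) (c%:E * f i))).
  by apply: lee_wpmul2l; rewrite ?lee_fin.
by rewrite muleA -EFinM mulfV// mul1e.
Qed.

(** Fubini by induction: splitting a tuple into head and tail gives an iterated sum, out of which
    each factor is pulled. *)
Lemma esum_prod_tuple (T : choiceType) (n : nat) (f : 'I_n -> T -> R) (m : 'I_n -> R) :
  (forall i y, 0 <= f i y)%R ->
  (forall i, \esum_(y in [set: T]) (f i y)%:E = (m i)%:E) ->
  \esum_(y in [set: n.-tuple T]) (\prod_(i < n) f i (tnth y i))%:E = (\prod_i m i)%:E.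
Proof.
elim: n f m => [|n IH] f m f0 fm.
  have -> : [set: 0.-tuple T] = [set [tuple]].
    by apply/seteqP; split => // t _ /=; rewrite tuple0.
  by rewrite esum_set1 ?big_ord0.
pose e (p : T * n.-tuple T) := [tuple of p.1 :: p.2].
have bij : set_bij ([set: T] `*`` (fun=> [set: n.-tuple T])) [set: n.+1.-tuple T] e.
  split => //.
  - by move=> [a s] [b t] _ _ /= /(congr1 val) /= [-> /val_inj ->].
  - by move=> t _; exists (thead t, [tuple of behead t]) => //=; rewrite [RHS]tuple_eta.
rewrite (reindex_esum _ _ _ _ bij) -(@esum_esum R T _ [set: T] (fun=> [set: n.-tuple T])
  (fun y t => (\prod_(i < n.+1) f i (tnth (e (y, t)) i))%:E)); last first.
  by move=> y t _ _; rewrite lee_fin; apply: prodr_ge0.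
have step y t : (\prod_(i < n.+1) f i (tnth (e (y, t)) i))%:E =
    (f ord0 y)%:E * (\prod_(i < n) f (lift ord0 i) (tnth t i))%:E.
  rewrite big_ord_recl -EFinM; congr (_ * _)%:E; apply: eq_bigr => i _.
  by rewrite tnthS.
under eq_esum.
  move=> y _; under eq_esum do rewrite step.
  rewrite esumZl//; last by move=> t; rewrite lee_fin; apply: prodr_ge0.
  rewrite (IH (fun i => f (lift ord0 i)) (fun i => m (lift ord0 i)))// muleC.
  over.
have m0 i : (0 <= m i)%R.
  by rewrite -lee_fin -fm; apply: esum_ge0 => y _; rewrite lee_fin.
rewrite esumZl ?prodr_ge0//; last by move=> y; rewrite lee_fin.
by rewrite fm big_ord_recl muleC.
Qed.

Lemma esum_probability (d : measure_display) (Y : measurableType d)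
    (P : probability Y R) (A : set Y) :
  discrete_space Y -> P A = \esum_(y in A) P [set y].
Proof.
move=> [/countable_injP[f injf] mY].
have {}injf x y : f x = f y -> x = y by apply: injf; rewrite inE.
pose F k := A `&` f @^-1` [set k].
have tF : trivIset setT F.
  by apply/trivIsetP => i j _ _ ij; apply/seteqP; split => // y [[_ /= yi] [_ /= yj]];
     move: ij; rewrite -yi -yj eqxx.
have AF : A = \bigcup_k F k.
  by apply/seteqP; split => [y Ay|y [k _ []]//]; exists (f y).
rewrite {1}AF measure_bigcup// nneseries_esum//.
rewrite (_ : [set x | x \in [set: nat]] = [set: nat]); last first.
  by apply/seteqP; split => // k _; rewrite /= in_setT.
rewrite (esumID (f @` A))// setTI [X in _ + X]esum1 ?adde0; last first.
  move=> k [_ nAk]; rewrite (_ : F k = set0) ?measure0//.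
  by apply/seteqP; split => // y [Ay fy]; apply: nAk; exists y.
rewrite esum_image; last by move=> x y _ _; exact: injf.
apply: eq_esum => y Ay; congr (P _).
by apply/seteqP; split => [z [_ /injf]//|z ->].
Qed.
End Esum.

(** * The output law of a codeword: union bound, moment generating function, Chernoff bound *)

Section ChannelPow.
Context {R : realType} {X : Type} {d : measure_display} {Y : measurableType d}.
Variables (W : X -> probability Y R) (n : nat) (u : n.-tuple X).
Hypothesis discY : discrete_space Y.

Let p (A : set Y) (i : 'I_n) : R := fine (W (tnth u i) A).

Lemma EFin_letter A i : (p A i)%:E = W (tnth u i) A.
Proof. by rewrite fineK// fin_num_measure//; exact: discY.2. Qed.

Lemma letter_ge0 A i : 0 <= p A i.
Proof. by rewrite fine_ge0. Qed.

Lemma letter_le1 A i : p A i <= 1.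
Proof. by rewrite -lee_fin EFin_letter probability_le1//; exact: discY.2. Qed.

Lemma channel_powE (D : set (n.-tuple Y)) :
  channel_pow W u D = (\esum_(y in D) (\prod_(i < n) p [set tnth y i] i)%:E)%E.
Proof.
apply: eq_esum => y _; rewrite (big_morph EFin (@EFinM R) (erefl _)).
by apply: eq_bigr => i _; rewrite EFin_letter.
Qed.

Lemma le_channel_pow (D D' : set (n.-tuple Y)) :
  D `<=` D' -> (channel_pow W u D <= channel_pow W u D')%E.
Proof.
move=> DD'; rewrite !channel_powE esum_mkcond [leRHS]esum_mkcond.
have g0 (y : n.-tuple Y) : (0 <= (\prod_(i < n) p [set tnth y i] i)%:E)%E.
  by rewrite lee_fin; apply: prodr_ge0 => i _; exact: letter_ge0.
apply: le_esum => y _; case: ifPn => [/set_mem/DD'/mem_set ->//|_].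
by case: ifP.
Qed.

Lemma channel_powU (D D' : set (n.-tuple Y)) :
  (channel_pow W u (D `|` D') <= channel_pow W u D + channel_pow W u D')%E.
Proof.
have g0 (y : n.-tuple Y) : (0 <= (\prod_(i < n) p [set tnth y i] i)%:E)%E.
  by rewrite lee_fin; apply: prodr_ge0 => i _; exact: letter_ge0.
rewrite !channel_powE esum_mkcond [in leRHS]esum_mkcond [X in (_ <= _ + X)%E]esum_mkcond.
rewrite -esumD; [|by move=> y _; case: ifP..].
apply: le_esum => y _; rewrite in_setU.
by case: (y \in D); case: (y \in D') => //=; rewrite ?adde0 ?add0e// leeDl.
Qed.

Lemma channel_pow_bigcup (m : nat) (D : 'I_m -> set (n.-tuple Y)) (b : R) :
  (forall k, (channel_pow W u (D k) <= b%:E)%E) ->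
  (channel_pow W u (\bigcup_(k in [set: 'I_m]) D k) <= (m%:R * b)%:E)%E.
Proof.
elim: m D => [|m IH] D Db.
  rewrite (_ : \bigcup_(k in _) _ = set0) ?mul0r; last first.
    by apply/seteqP; split => // y [[]].
  by rewrite /channel_pow esum_set0.
have -> : \bigcup_(k in [set: 'I_m.+1]) D k =
    D ord0 `|` \bigcup_(k in [set: 'I_m]) D (lift ord0 k).
  apply/seteqP; split => [y [k _ Dy]|y [Dy|[k _ Dy]]].
  - by have [j kj|k0] := unliftP ord0 k; [right; exists j; rewrite -?kj|left; rewrite -k0].
  - by exists ord0.
  - by exists (lift ord0 k).
apply: le_trans (channel_powU _ _) _.
rewrite -[m.+1%:R]natr1 mulrDl mul1r addrC EFinD leeD//.
exact: IH.
Qed.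

Lemma esum_mgf (i : 'I_n) (A : set Y) (x : R) :
  (\esum_(y in [set: Y]) (p [set y] i * expR (x * \1_A y))%:E)%E =
  (1 + p A i * (expR x - 1))%:E.
Proof.
have half (B : set Y) (c : R) : (forall y, B y -> expR (x * \1_A y) = c) ->
    (\esum_(y in B) (p [set y] i * expR (x * \1_A y))%:E)%E = (c * p B i)%:E.
  (* For empty [B] the sign of [c] is unknown and [esumZl] does not apply, but both sides vanish. *)
  move=> Bc; have [[y0 By0]|nB] := pselect (exists y, B y); last first.
    have -> : B = set0 by apply/seteqP; split => // y By; apply: nB; exists y.
    by rewrite esum_set0 /p measure0 mulr0.
  have c0 : 0 <= c by rewrite -(Bc _ By0) expR_ge0.
  rewrite EFinM EFin_letter (esum_probability _ _ discY) -esumZl//.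
  by apply: eq_esum => y By; rewrite Bc// mulrC EFinM EFin_letter.
rewrite (esumID A); last by move=> y _; rewrite lee_fin mulr_ge0 ?letter_ge0 ?expR_ge0.
rewrite !setTI (half A (expR x)); last by move=> y Ay; rewrite indicE mem_set// mulr1.
rewrite (half (~` A) 1); last by move=> y Ay; rewrite indicE memNset// mulr0 expR0.
have -> : p (~` A) i = 1 - p A i.
  apply: EFin_inj; rewrite EFinB !EFin_letter probability_setC//; exact: discY.2.
by rewrite -EFinD; congr (_%:E); ring.
Qed.

(** By independence the mean of the exponential is the product of the Bernoulli generating functions
    of [esum_mgf]. *)
Lemma channel_pow_mgf (A : set Y) (x : 'I_n -> R) :
  (\esum_(y in [set: n.-tuple Y])
    (expR (\sum_i x i * \1_A (tnth y i)) * \prod_(i < n) p [set tnth y i] i)%:E)%E =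
  (\prod_i (1 + p A i * (expR (x i) - 1)))%:E.
Proof.
rewrite -(@esum_prod_tuple _ _ _ (fun i y => p [set y] i * expR (x i * \1_A y))); first last.
- by move=> i; exact: esum_mgf.
- by move=> i y; rewrite mulr_ge0 ?letter_ge0 ?expR_ge0.
by apply: eq_esum => y _; rewrite big_split/= expR_sum mulrC.
Qed.

Lemma channel_powT : channel_pow W u [set: n.-tuple Y] = 1%E.
Proof.
have := channel_pow_mgf set0 (fun=> 0).
rewrite [in RHS]big1; last by move=> i _; rewrite expR0; ring.
move=> mgf1; rewrite channel_powE -[RHS]mgf1; apply: eq_esum => y _.
by congr (_%:E); rewrite [X in expR X]big1 ?expR0 ?mul1r// => i _; rewrite mul0r.
Qed.

(** [expR x] is at most [1 / (1 - x)], and [(1 + x + 2 x^2) (1 - x) = 1 + x^2 (1 - 2 x)] is at least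
    1 in this range. *)
Lemma expR_le_quadratic (x : R) : x <= 1 / 2 -> expR x <= 1 + x + 2 * x ^+ 2.
Proof.
move=> x2; rewrite -[expR x]invrK -expRN.
have h : 0 < 1 - x by lra.
apply: (@le_trans _ _ (1 - x)^-1).
  by rewrite lef_pV2 ?posrE ?expR_gt0// expR_ge1Dx.
rewrite -[X in X <= _]mul1r ler_pdivrMr//.
have -> : (1 + x + 2 * x ^+ 2) * (1 - x) = 1 + x ^+ 2 * (1 - 2 * x) by ring.
by rewrite lerDl mulr_ge0 ?sqr_ge0//; lra.
Qed.

(* [x] is already multiplied by the Chernoff parameter. *)
Lemma chernoff (A : set Y) (x : 'I_n -> R) (tau : R) :
  (forall i, x i <= 1 / 2) ->
  (channel_pow W u [set y | (tau <= \sum_i x i * \1_A (tnth y i))%R] <=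
   (expR (\sum_i x i * p A i + 2 * \sum_i x i ^+ 2 - tau))%:E)%E.
Proof.
move=> x2; rewrite channel_powE esum_mkcond.
have g0 (y : n.-tuple Y) : (0 <= \prod_(i < n) p [set tnth y i] i).
  by apply: prodr_ge0 => i _; exact: letter_ge0.
(* Markov's inequality: on the event, [expR] of the sum minus [tau] is at least 1. *)
apply: (@le_trans _ _ (\esum_(y in [set: n.-tuple Y]) ((expR (- tau))%:E *
  (expR (\sum_i x i * \1_A (tnth y i)) * \prod_(i < n) p [set tnth y i] i)%:E))%E).
  apply: le_esum => y _; rewrite -EFinM; case: ifPn => [/set_mem/= tauy|_].
    by rewrite lee_fin mulrA -expRD ler_peMl// -expR0 ler_expR; lra.
  by rewrite lee_fin !mulr_ge0// expR_ge0.
rewrite esumZl ?expR_ge0//; last by move=> y; rewrite lee_fin mulr_ge0// expR_ge0.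
rewrite channel_pow_mgf -EFinM lee_fin addrC expRD ler_wpM2l ?expR_ge0//.
rewrite mulr_sumr -big_split/= expR_sum; apply: ler_prod => i _.
have := expR_le_quadratic (x2 i); have := expR_gt0 (x i).
move: (letter_ge0 A i) (letter_le1 A i) (sqr_ge0 (x i)); set q := p A i; set z := x i.
set e := expR z; set s := z ^+ 2 => q0 q1 s0 e0 es; apply/andP; split.
  have : 0 <= q * e by rewrite mulr_ge0// ltW.
  lra.
(* By [1 + t <= expR t] it remains to bound [q * (e - 1)] by [z * q + 2 * s], where [q <= 1] lets
   the quadratic term lose its factor [q]. *)
apply: le_trans (expR_ge1Dx _); rewrite lerD2l.
apply: (@le_trans _ _ (q * (z + 2 * s))); first by rewrite ler_wpM2l//; lra.
by rewrite mulrDr [z * q]mulrC lerD2l ler_piMl//; lra.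
Qed.
End ChannelPow.

(** * From a continuous curve of laws to an interval of event probabilities *)

Lemma le_tv_dist (R : realType) (d : measure_display) (Y : measurableType d)
    (P Q : probability Y R) (A : set Y) :
  measurable A -> `|fine (P A) - fine (Q A)| <= tv_dist P Q.
Proof.
move=> mA; apply: ub_le_sup; last by exists A.
exists 1 => _ [B mB <-].
have in01 (P' : probability Y R) : 0 <= fine (P' B) <= 1.
  rewrite fine_ge0//= -lee_fin fineK ?probability_le1//.
  by rewrite fin_num_measure.
have /andP[p0 p1] := in01 P; have /andP[q0 q1] := in01 Q.
by rewrite ler_norml; apply/andP; split; lra.
Qed.

(** An event that separates two points of the curve has a probability that varies continuously along
    it, since total variation dominates its increments; the intermediate value theorem fills the
    interval. *)
Lemma Bernoulli_reducible_range (R : realType) (X : Type) (d : measure_display)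
    (Y : measurableType d) (W : X -> probability Y R) :
  discrete_space Y -> Bernoulli_reducible W ->
  exists (A : set Y) (a b : R), [/\ 0 <= a, a < b, b <= 1 &
    forall p, a <= p <= b -> exists x, fine (W x A) = p].
Proof.
move=> [_ mY] [gamma [gcont [s [t [s01 t01 gst]]] gW]].
have [A gA] : exists A, fine (gamma s A) != fine (gamma t A).
  apply: contrapT => nA; apply: gst => A.
  have [/eqP eqA|neqA] := boolP (fine (gamma s A) == fine (gamma t A)).
    by rewrite -[LHS]fineK ?fin_num_measure// eqA fineK// fin_num_measure.
  by exfalso; apply: nA; exists A.
pose f r := fine (gamma r A).
have f01 r : 0 <= f r <= 1.
  rewrite /f fine_ge0//= -lee_fin fineK ?probability_le1//.
  by rewrite fin_num_measure.
have cf : {within `[0, 1], continuous f}.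
  apply/subspace_continuousP => r /=; rewrite in_itv/= => r01.
  apply/cvgrPdist_lt => eps eps0.
  have /cvgrPdist_lt/(_ _ eps0) := gcont r r01.
  apply: filterS => q; rewrite sub0r normrN; apply: le_lt_trans.
  by rewrite distrC (le_trans (le_tv_dist _ _ (mY A)))// ler_norm.
(* This orders the values of [f], not the parameters [s] and [t], whose two orders are treated
   separately below. *)
wlog fst : s t s01 t01 gst gA / f s < f t => [hw|].
  have [fst|fts|] := ltgtP (f s) (f t).
  - exact: (hw s t).
  - by apply: (hw t s) => //; [move=> h; apply: gst => B; rewrite h|rewrite eq_sym].
  - by move/eqP; rewrite (negbTE gA).
exists A, (f s), (f t); split => //.
- by case/andP: (f01 s).
- by case/andP: (f01 t).
move=> p /andP[sp pt].
have fx r : 0 <= r <= 1 -> f r = p -> exists x, fine (W x A) = p.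
  by move=> /gW[x Wx] <-; exists x; rewrite Wx.
move: s01 t01 => /andP[s0 s1] /andP[t0 t1].
have [st|ts] := leP s t.
  have [||q qst fq] := @IVT _ f s t p st.
  - apply: continuous_subspaceW cf => q /=; rewrite !in_itv/= => /andP[? ?].
    by apply/andP; split; lra.
  - by rewrite ge_min sp/= le_max pt orbT.
  by apply: (fx q) => //; move: qst; rewrite in_itv/= => /andP[? ?]; apply/andP; split; lra.
have [||q qst fq] := @IVT _ f t s p (ltW ts).
- apply: continuous_subspaceW cf => q /=; rewrite !in_itv/= => /andP[? ?].
  by apply/andP; split; lra.
- by rewrite ge_min sp orbT/= le_max pt.
by apply: (fx q) => //; move: qst; rewrite in_itv/= => /andP[? ?]; apply/andP; split; lra.
Qed.

(** * Codewords, decision regions and the two error bounds *)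

Lemma sqr_dist_ge (R : realType) (x y X : nat) :
  (X <= 2 * (x - y) + 2 * (y - x))%N ->
  (X%:R : R) ^+ 2 <= 4 * (x%:R - y%:R) ^+ 2.
Proof.
move=> h; have {}h : (X%:R : R) <= 2 * `|x%:R - y%:R|.
  have [xy|/ltnW yx] := leqP x y.
    rewrite distrC ger0_norm ?subr_ge0 ?ler_nat// -natrB// -natrM ler_nat.
    by move: h; lia.
  rewrite ger0_norm ?subr_ge0 ?ler_nat// -natrB// -natrM ler_nat.
  by move: h; lia.
rewrite -[_ ^+ 2 in leRHS]real_normK ?num_real//.
have -> : 4 * `|x%:R - y%:R| ^+ 2 = (2 * `|x%:R - y%:R|) ^+ 2 :> R by ring.
by rewrite ler_sqr ?nnegrE// mulr_ge0.
Qed.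

(** There are [L.+1] digits and as many tests. The bound with constant 24 makes the separation beat
    the fluctuations in the worst case, a top differing digit at position 0; [e <= 1 / 4] keeps the
    Chernoff parameter [Num.sqrt e] at most 1/2. *)
Lemma DI_code_exists (R : realType) (X : Type) (d : measure_display)
    (Y : measurableType d) (W : X -> probability Y R) (A : set Y) (a b : R)
    (n M L : nat) (e : R) :
  discrete_space Y -> a < b ->
  (forall p, a <= p <= b -> exists x, fine (W x A) = p) ->
  (0 < n)%N -> (0 < M)%N -> 0 <= e -> e <= 1 / 4 ->
  24 * L.+2%:R * Num.sqrt e * (2 * M)%:R ^+ L.+2 <= b - a ->
  exists (N : nat) (u : 'I_N -> n.-tuple X) (D : 'I_N -> set (n.-tuple Y)),
    [/\ (0 < N)%N,
        DI_code W (L.+1%:R * expR (- (n%:R * e))) (expR (- (n%:R * e))) u D &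
        (M ^ (n * L.+1) <= N * (2 ^ n * M ^ (n %/ L.+2)) ^ L.+1
                           * (n * (2 * M) ^ (2 * L.+1)) ^ L.+1)%N].
Proof.
move=> discY ab Wp n_gt0 M_gt0 e0 e4 sep.
have [N [r [N_gt0 rlt rsep cardN]]] := multilevel_code L (n %/ L.+2) M_gt0 n_gt0.
set B := (2 * M)%N in rlt rsep sep.
have B_gt0 k : 0 < (B%:R : R) ^+ k by rewrite exprn_gt0// ltr0n muln_gt0 M_gt0.
have r_le m k i : 2 * (r m k i)%:R <= (B%:R : R) ^+ k.
  by rewrite -natrX -natrM ler_nat ltnW.
pose h := (b - a) / B%:R ^+ L.+1.
have h0 : 0 <= h by rewrite divr_ge0 ?subr_ge0 1?ltW.
pose P (m : 'I_N) i := a + h * (r m L.+1 i)%:R.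
have Pab m i : a <= P m i <= b.
  rewrite lerDl mulr_ge0//= -lerBrDl /h mulrAC ler_pdivrMr// ler_wpM2l//.
    by rewrite subr_ge0 ltW.
  by apply: le_trans (r_le m L.+1 i); rewrite ler_peMl// ler1n.
(* Choice needs a total function: outside [[a, b]] the letter for [a] serves as default. *)
have /choice[x xP] : forall p, exists x, a <= p <= b -> fine (W x A) = p.
  move=> p; have [/Wp[x Wx]|_] := boolP (a <= p <= b); first by exists x.
  have /Wp[x _] : a <= a <= b by rewrite lexx ltW.
  by exists x.
pose u m := [tuple x (P m i) | i < n].
have uP m i : fine (W (tnth (u m) i) A) = P m i by rewrite tnth_mktuple xP.
set q := Num.sqrt e in sep *.
have q0 : 0 <= q := sqrtr_ge0 e.
have qq : q ^+ 2 = e by rewrite sqr_sqrtr.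
have q2 : q <= 1 / 2 by rewrite -ler_sqr ?nnegrE// qq; lra.
(* The truncation is scaled into [[0, 1]] and multiplied by the Chernoff parameter, so its squares
   sum to at most [n * e]. *)
pose w m k i : R := q * (2 * (r m k.+1 i)%:R / B%:R ^+ k.+1).
have w0 m k i : 0 <= w m k i by rewrite mulr_ge0// divr_ge0 ?mulr_ge0// ltW.
have wq m k i : w m k i <= q.
  by rewrite -[leRHS]mulr1 ler_wpM2l// ler_pdivrMr// mul1r.
have sumw m k : \sum_i (w m k i) ^+ 2 <= n%:R * e.
  rewrite -[n%:R]mulr_natl mulr1 -[n in leRHS]card_ord mulr_natl -sumr_const.
  by apply: ler_sum => i _; rewrite -qq ler_sqr ?nnegrE.
(* Of the slack [3 * n * e], two parts absorb the quadratic term of [chernoff] and one is left as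
   the exponent. *)
pose tau m k := \sum_i w m k i * P m i - 3 * (n%:R * e).
pose D m := [set y : n.-tuple Y | forall k : 'I_L.+1, tau m k <= \sum_i w m k i * \1_A (tnth y i)].
exists N, u, D; split => // i j ij; split.
  have bad (k : 'I_L.+1) : (channel_pow W (u i)
      [set y | (- tau i k <= \sum_l (- w i k l) * \1_A (tnth y l))%R] <=
      (expR (- (n%:R * e)))%:E)%E.
    apply: le_trans (chernoff W (u i) discY A _ _) _.
      by move=> l; have := w0 i k l; lra.
    rewrite lee_fin ler_expR.
    under eq_bigr do rewrite uP mulNr.
    under [X in 2 * X]eq_bigr do rewrite sqrrN.
    by rewrite sumrN /tau; have := sumw i k; lra.
  have := channel_pow_bigcup discY bad.
  set Bad := \bigcup_(k in _) _ => badle.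
  have cov : [set: n.-tuple Y] `<=` D i `|` Bad.
    move=> y _; have [Dy|nDy] := pselect (D i y); first by left.
    right; have [k /negP kP] : exists k : 'I_L.+1, ~ (tau i k <= \sum_l w i k l * \1_A (tnth y l)).
      by apply: contrapT => nk; apply: nDy => k; apply: contrapT => kP; apply: nk; exists k.
    exists k => //=; under eq_bigr do rewrite mulNr.
    by rewrite sumrN lerN2 ltW// ltNge.
  have := le_trans (le_channel_pow W (u i) discY cov) (channel_powU W (u i) discY _ _).
  rewrite (channel_powT _ _ discY) => one_le.
  rewrite EFinB leeBlDr//; apply: le_trans one_le _.
  by rewrite leeD2l.
(* An output in [D j] passes test [k] of [j], where [k] is the top differing position; this single
   test bounds the second error. *)
have [|k [kL rd rn rH]] := rsep j i; first by rewrite eq_sym.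
apply: (@le_trans _ _ (channel_pow W (u i) [set y | (tau j k <= \sum_l w j k l * \1_A (tnth y l))%R])).
  by apply: (le_channel_pow W (u i) discY) => y /(_ (Ordinal kL)).
apply: le_trans (chernoff W (u i) discY A _ _) _.
  by move=> l; apply: le_trans (wq j k l) q2.
rewrite lee_fin ler_expR.
under eq_bigr do rewrite uP.
pose S := \sum_l ((r j k.+1 l)%:R - (r i k.+1 l)%:R : R) ^+ 2.
have gap : \sum_l w j k l * P j l - \sum_l w j k l * P i l = q * h / B%:R ^+ k.+1 * S.
  (* The equality of norms makes the linear term quadratic. *)
  have -> : S = \sum_l 2 * (r j k.+1 l)%:R * ((r j k.+1 l)%:R - (r i k.+1 l)%:R).
    have sq m : \sum_l ((r m k.+1 l)%:R : R) ^+ 2 = (\sum_l r m k.+1 l ^ 2)%:R.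
      by rewrite natr_sum; apply: eq_bigr => l _; rewrite natrX.
    have := congr1 (fun v : nat => v%:R : R) rn; rewrite /= -!sq => /eqP.
    rewrite -subr_eq0 -sumrB => /eqP rn0.
    rewrite -[LHS]addr0 -[X in _ + X]rn0 -big_split; apply: eq_bigr => l _ /=; ring.
  rewrite mulr_sumr -sumrB; apply: eq_bigr => l _.
  have {}rd : (r j L.+1 l)%:R - (r i L.+1 l)%:R = (r j k.+1 l)%:R - (r i k.+1 l)%:R :> R.
    by have := congr1 (fun v : nat => v%:R : R) (rd l); rewrite /= !natrD; lra.
  by rewrite -rd /w /P; ring.
have S_ge : n%:R / L.+2%:R * (B%:R ^+ k) ^+ 2 / 4 <= S.
  set H := [set l | _]%SET in rH.
  apply: (@le_trans _ _ (\sum_(l in H) (B%:R ^+ k) ^+ 2 / 4)).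
    rewrite sumr_const -[leRHS]mulr_natl -[leLHS]mulrA ler_wpM2r ?divr_ge0 ?sqr_ge0//.
    rewrite ler_pdivrMr ?ltr0n// -natrM ler_nat.
    (* The strict bound on the number of distant positions makes up for the rounding in
       [n %/ L.+2]. *)
    by have := ltn_ceil n (isT : 0 < L.+2)%N; move: rH; nia.
  rewrite /S [leRHS](bigID (mem H))/= -[leLHS]addr0 lerD ?sumr_ge0//; last first.
    by move=> l _; exact: sqr_ge0.
  apply: ler_sum => l; rewrite inE => /(@sqr_dist_ge R).
  by rewrite natrX; lra.
(* Six parts: three for the slack in [tau], two for the quadratic term, one for the exponent. *)
have big : 6 * (n%:R * e) <= q * h / B%:R ^+ k.+1 * S.
  have qh0 : 0 <= q * h / B%:R ^+ k.+1 by apply: divr_ge0; [exact: mulr_ge0|exact: ltW].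
  apply: le_trans (ler_wpM2l qh0 S_ge).
  have -> : q * h / B%:R ^+ k.+1 * (n%:R / L.+2%:R * (B%:R ^+ k) ^+ 2 / 4) =
      n%:R * q * (B%:R ^+ k * (b - a) / (4 * L.+2%:R * B%:R ^+ L.+2)).
    have Bn0 m : (B%:R : R) ^+ m != 0 by rewrite gt_eqF.
    have := Bn0 k; have := Bn0 L; have := Bn0 1%N; rewrite expr1 /h !exprS.
    rewrite expr0 => B1 BL Bk; have L2 : (L.+2%:R : R) != 0 by rewrite pnatr_eq0.
    by field; apply/and4P; split => //; rewrite -(natrD R 2 L).
  rewrite -qq expr2 [6 * _](_ : _ = n%:R * q * (6 * q)); last by ring.
  rewrite ler_wpM2l ?mulr_ge0// ler_pdivlMr; last by apply: mulr_gt0 (B_gt0 _); rewrite mulr_gt0 ?ltr0n.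
  apply: (@le_trans _ _ (b - a)); first by apply: le_trans sep; rewrite le_eqVlt; apply/orP; left; apply/eqP; ring.
  by rewrite ler_peMl ?subr_ge0 ?(ltW ab)// -natrX ler1n expn_gt0 muln_gt0 M_gt0.
by have := sumw j k; rewrite /tau; lra.
Qed.

(** * Base 2 logarithms and the rate of the code *)

Section Log2.
Context {R : realType}.
Implicit Types x y : R.

Let ln2_gt0 : 0 < ln (2 : R).
Proof. by rewrite ln_gt0// ltr1n. Qed.

Lemma log2M x y : 0 < x -> 0 < y -> log2 (x * y) = log2 x + log2 y.
Proof. by move=> x0 y0; rewrite /log2 lnM ?posrE// mulrDl. Qed.

Lemma log2X x n : 0 < x -> log2 (x ^+ n) = n%:R * log2 x.
Proof. by move=> x0; rewrite /log2 lnXn// -[ln x *+ n]mulr_natl mulrA. Qed.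

Lemma log2V x : 0 < x -> log2 x^-1 = - log2 x.
Proof. by move=> x0; rewrite /log2 lnV ?posrE// mulNr. Qed.

Lemma log2_2 : log2 (2 : R) = 1.
Proof. by rewrite /log2 divff// gt_eqF. Qed.

Lemma ler_log2 x y : 0 < x -> x <= y -> log2 x <= log2 y.
Proof.
move=> x0 xy; rewrite /log2 ler_pM2r ?invr_gt0// ler_ln// posrE//.
exact: lt_le_trans xy.
Qed.

Lemma log2_ge0 x : 1 <= x -> 0 <= log2 x.
Proof. by move=> x1; rewrite /log2 divr_ge0 ?ln_ge0 ?ler1n. Qed.

Lemma log2_nat_le n : (0 < n)%N -> log2 (n%:R : R) <= n%:R.
Proof.
move=> n0; have := log2X n (ltr0Sn R 1); rewrite log2_2 mulr1 => log2n.
by rewrite -[leRHS]log2n; apply: ler_log2; rewrite ?ltr0n// -natrX ler_nat ltnW// ltn_expl.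
Qed.

(** Since [ln 2 <= 1], the base [e] errors of the Chernoff bound meet the base 2 requirement. *)
Lemma expR_le_powR2 x : 0 <= x -> expR (- x) <= (2 : R) `^ (- x).
Proof.
move=> x0; rewrite /powR pnatr_eq0/= ler_expR mulNr lerN2 ler_piMr//.
rewrite -[leRHS]expRK ler_ln ?posrE ?expR_gt0//.
exact: expR_ge1Dx 1.
Qed.
End Log2.

Lemma le_DI_code (R : realType) (X : Type) (d : measure_display)
    (Y : measurableType d) (W : X -> probability Y R) (n N : nat)
    (lambda1 lambda2 lambda1' lambda2' : R)
    (u : 'I_N -> n.-tuple X) (D : 'I_N -> set (n.-tuple Y)) :
  lambda1 <= lambda1' -> lambda2 <= lambda2' ->
  DI_code W lambda1 lambda2 u D -> DI_code W lambda1' lambda2' u D.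
Proof.
move=> l1 l2 code i j /code[ui uj]; split; last first.
  by apply: le_trans uj _; rewrite lee_fin.
by apply: le_trans ui; rewrite lee_fin lerD2l lerN2.
Qed.

(** [M] is the largest [m] with [q * (2 * m) ^ T <= kappa]; the value 1 qualifies by hypothesis,
    [M + 1] fails, and [2 * (M + 1) <= 4 * M]. *)
Lemma digit_count (R : realType) (T : nat) (q kappa : R) :
  (0 < T)%N -> 0 < q -> 2 ^+ T * q <= kappa ->
  exists M : nat, [/\ (0 < M)%N, q * (2 * M)%:R ^+ T <= kappa &
    kappa <= q * (4 * M)%:R ^+ T].
Proof.
move=> T0 q0 qk.
pose P m := q * (2 * m)%:R ^+ T <= kappa.
have P1 : P 1%N by rewrite /P muln1 mulrC.
have k0 : 0 < kappa by apply: lt_le_trans qk; rewrite mulr_gt0// exprn_gt0.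
have ub m : P m -> (m <= Num.truncn (kappa / q))%N.
  move=> Pm; have [->//|m0] := posnP m.
  rewrite truncn_ge_nat ?(divr_ge0 (ltW k0) (ltW q0))// ler_pdivlMr//; apply: le_trans Pm.
  rewrite mulrC (ler_wpM2l (ltW q0))//; apply: (@le_trans _ _ (2 * m)%:R).
    by rewrite ler_nat leq_pmull.
  rewrite -natrX ler_nat -[leqLHS]expn1 leq_pexp2l//.
  by rewrite muln_gt0.
have [M PM maxM] := ex_maxnP (ex_intro (fun m => P m) 1%N P1) ub.
have M0 : (0 < M)%N := maxM _ P1.
exists M; split => //.
have : ~~ P M.+1 by apply/negP => /maxM; rewrite ltnn.
rewrite /P -ltNge => /ltW /le_trans; apply.
rewrite (ler_wpM2l (ltW q0))// lerXn2r ?nnegrE// ler_nat; lia.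
Qed.

(* Since [n * e >= 1], both [n] and [2 * M <= n] cost only [O(log n)] bits in
   the pigeonhole, hence [O(1)] in rate. *)
Lemma rate_bound (R : realType) (n N M L : nat) (e kappa : R) :
  (0 < n)%N -> (0 < N)%N -> (0 < M)%N -> 0 < e -> e <= 1 -> 1 <= n%:R * e ->
  0 < kappa -> kappa <= 1 ->
  Num.sqrt e * (2 * M)%:R ^+ L.+2 <= kappa ->
  kappa <= Num.sqrt e * (4 * M)%:R ^+ L.+2 ->
  (M ^ (n * L.+1) <= N * (2 ^ n * M ^ (n %/ L.+2)) ^ L.+1
                     * (n * (2 * M) ^ (2 * L.+1)) ^ L.+1)%N ->
  (1 - 2 / L.+2%:R) / 2 * log2 (1 / e)
    - (4 * L.+1%:R ^+ 2 + 2 * L.+1%:R - log2 kappa) <= log2 (N%:R : R) / n%:R.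
Proof.
move=> n0 N0 M0 e0 e1 ne k0 k1 Mle Mge card.
have q0 : 0 < Num.sqrt e by rewrite sqrtr_gt0.
have lq : log2 (Num.sqrt e) = log2 e / 2.
  by have := log2X 2 q0; rewrite sqr_sqrtr ?(ltW e0)//; lra.
have nR : 0 < (n%:R : R) by rewrite ltr0n.
have MR : 0 < (M%:R : R) by rewrite ltr0n.
have lM0 : 0 <= log2 (M%:R : R) by rewrite log2_ge0// ler1n.
have lM : log2 kappa + log2 (1 / e) / 2 <= L.+2%:R * (2 + log2 (M%:R : R)).
  have := ler_log2 k0 Mge.
  rewrite log2M ?exprn_gt0 ?ltr0n ?muln_gt0// log2X ?ltr0n ?muln_gt0//.
  have -> : log2 ((4 * M)%:R : R) = 2 + log2 (M%:R : R).
    rewrite natrM log2M// (_ : 4 = 2 ^+ 2 :> R) ?log2X ?log2_2 ?mulr1//; ring.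
  by rewrite lq div1r log2V//; lra.
have l2M : log2 ((2 * M)%:R : R) <= n%:R.
  apply: le_trans (log2_nat_le n0).
  have M2 : (1 : R) <= (2 * M)%:R by rewrite ler1n muln_gt0.
  apply: ler_log2; first by rewrite (lt_le_trans ltr01).
  (* Squaring gives [(2 * M)^2 * e <= 1 <= n * e], hence [2 * M <= n]. *)
  have h1 : (2 * M)%:R * Num.sqrt e <= 1.
    apply: le_trans k1; apply: le_trans Mle; rewrite mulrC (ler_wpM2l (ltW q0))//.
    by rewrite exprS ler_peMr ?exprn_ege1// ltW// (lt_le_trans ltr01).
  have h2 : (2 * M)%:R * (2 * M)%:R * e <= 1.
    rewrite -(sqr_sqrtr (ltW e0)) expr2 mulrACA.
    by rewrite mulr_ile1// mulr_ge0// ltW// (lt_le_trans ltr01).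
  have h3 : (2 * M)%:R * e <= n%:R * e.
    apply: le_trans ne; apply: le_trans h2.
    rewrite ler_wpM2r ?(ltW e0)// ler_peMr// ltW// (lt_le_trans ltr01)//.
  by rewrite ler_pM2r in h3.
have dn : ((n %/ L.+2)%:R : R) <= n%:R / L.+2%:R.
  by rewrite ler_pdivlMr ?ltr0n// -natrM ler_nat leq_divM.
have ln_n := @log2_nat_le R n n0.
have main : n%:R * L.+1%:R * log2 (M%:R : R) <= log2 (N%:R : R)
   + L.+1%:R * (n%:R + (n %/ L.+2)%:R * log2 (M%:R : R))
   + L.+1%:R * (log2 (n%:R : R) + 2 * L.+1%:R * log2 ((2 * M)%:R : R)).
  have cardR : (M%:R : R) ^+ (n * L.+1) <= N%:R * (2 ^+ n * M%:R ^+ (n %/ L.+2)) ^+ L.+1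
      * (n%:R * (2 * M)%:R ^+ (2 * L.+1)) ^+ L.+1.
    by move: card; rewrite -(ler_nat R) !(natrM, natrX).
  have NR : 0 < (N%:R : R) by rewrite ltr0n.
  have MMR : 0 < ((2 * M)%:R : R) by rewrite ltr0n muln_gt0.
  have c1 : 0 < (2 : R) ^+ n * M%:R ^+ (n %/ L.+2) by rewrite mulr_gt0 ?exprn_gt0.
  have c2 : 0 < (n%:R : R) * (2 * M)%:R ^+ (2 * L.+1) by rewrite mulr_gt0 ?exprn_gt0.
  have := ler_log2 (exprn_gt0 _ MR) cardR.
  rewrite log2M ?(mulr_gt0 NR) ?exprn_gt0// (log2M NR) ?exprn_gt0//.
  rewrite !log2X// log2M ?exprn_gt0// log2M ?exprn_gt0// !log2X// log2_2 mulr1.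
  by rewrite !natrM.
move: lM dn main; have -> : (L.+2%:R : R) = L.+1%:R + 1 by rewrite natr1.
have l1 : (1 : R) <= L.+1%:R by rewrite ler1n.
move: (L.+1%:R : R) l1 => l l1 lM dn main.
have T0 : 0 < l + 1 by lra.
pose s := (l + 1)^-1.
have sT : s * (l + 1) = 1 by rewrite mulVf// gt_eqF.
have s0 : 0 <= s by rewrite invr_ge0 ltW.
have ls : l * s = 1 - s by lra.
have lk : log2 kappa <= 0 by rewrite -oppr_ge0 -log2V// log2_ge0// invf_ge1.
have le : 0 <= log2 (1 / e) by rewrite log2_ge0// div1r invf_ge1.
rewrite ler_pdivlMr// -/s.
move: (log2 (1 / e)) (log2 kappa) (log2 (M%:R : R)) (log2 (N%:R : R))
  (log2 ((2 * M)%N%:R : R)) ((n %/ L.+2)%N%:R : R) (n%:R : R) le lk lM0 lM l2M dn ln_n main nR {ne}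
  => G K x y z D n' G0 K0 x0 xT zn Dn vn main n'0.
have l0 : 0 <= l by lra.
have step1 : n' * (l * x * (1 - s) - 2 * l - 2 * l ^+ 2) <= y.
  have h1 : l * (D * x) <= l * (n' * s * x) by rewrite ler_wpM2l ?ler_wpM2r//; lra.
  have h2 : l * log2 n' <= l * n' by rewrite ler_wpM2l.
  have h3 : l * (l * z) <= l * (l * n') by rewrite !ler_wpM2l.
  by move: main h1 h2 h3; rewrite expr2; lra.
apply: le_trans step1; rewrite mulrC ler_wpM2l ?(ltW n'0)//.
(* The factor is [(1 - s)^2]: one [1 - s = l * s] because [l] digits share a budget of [l + 1], the
   other from the distance of the outer codes. It is at least [1 - 2 * s], whence the form of
   [eta]. *)
have xs : s * (K + G / 2) <= 2 + x by have := ler_wpM2l s0 xT; rewrite mulrA sT mul1r.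
have s1 : s <= 1 by have := mulr_ge0 l0 s0; lra.
have t0 : 0 <= 1 - s by lra.
have lt : 0 <= l * (1 - s) by rewrite mulr_ge0//; lra.
have h1 : l * (1 - s) * (s * (K + G / 2)) <= l * (1 - s) * (2 + x).
  exact: ler_wpM2l.
have h1' : l * (1 - s) * (s * (K + G / 2)) = (1 - s) ^+ 2 * (K + G / 2).
  have -> : l * (1 - s) * (s * (K + G / 2)) = l * s * ((1 - s) * (K + G / 2)) by ring.
  by rewrite ls; ring.
have h2 : 0 <= (1 - (1 - s) ^+ 2) * (- K).
  rewrite mulr_ge0//; last lra.
  by rewrite subr_ge0 expr_le1//; lra.
have h3 : 0 <= s ^+ 2 * G by rewrite mulr_ge0// sqr_ge0.
have h4 : 0 <= l * (l - (1 - s)) by rewrite mulr_ge0//; lra.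
by move: h1 h2 h3 h4; rewrite h1' !expr2; lra.
Qed.

(** * Choice of the constants and conclusion *)

Unset Implicit Arguments.

Theorem theorem15 (R : realType) :
  exists eta : nat -> R,
    [/\ forall L : nat, (1 <= L)%N -> 0 < eta L,
        eta L @[L --> \oo] --> (0 : R) &
        forall (delta : R) (L : nat), 0 < delta -> (1 <= L)%N ->
        forall (X : Type) (d : measure_display) (Y : measurableType d)
          (W : X -> probability Y R),
          discrete_space Y -> Bernoulli_reducible W ->
        exists C : R,
        forall E : nat -> R,
          (forall n : nat, (1 <= n)%N -> 0 < E n) ->
          (n%:R * E n @[n --> \oo] --> +oo) ->
          (forall n : nat, (2 <= n)%N -> E n < 1 / (delta * log2 (n%:R : R))) ->
        \forall n \near \oo,
          exists (N : nat) (u : 'I_N -> n.-tuple X)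
                 (D : 'I_N -> set (n.-tuple Y)),
            [/\ (1 <= N)%N,
                DI_code W (L%:R * (2 : R) `^ (- (n%:R * E n)))
                          ((2 : R) `^ (- (n%:R * E n))) u D &
                log2 (N%:R : R) / n%:R >=
                  (1 - eta L) / 2 * log2 (1 / E n - delta * log2 (n%:R : R)) - C]].
Proof.
exists (fun L => 2 / L.+1%:R); split.
- by move=> L _; rewrite divr_gt0.
- by rewrite -[X in _ --> X](mulr0 2); apply: cvgMr; exact: cvg_harmonic.
(* The given parameter becomes [L.+1], so [eta] reads [2 / L.+2] as in [rate_bound]. *)
move=> delta [//|L] delta0 _ X d Y W discY /(Bernoulli_reducible_range discY).
move=> [A [a [b [a0 ab b1 Wp]]]].
(* [kappa] is the bound on [Num.sqrt e * (2 * M) ^ L.+2] that [DI_code_exists] asks for. *)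
pose kappa : R := (b - a) / (24 * L.+2%:R).
have T0 : 0 < 24 * L.+2%:R :> R by rewrite mulr_gt0.
have k0 : 0 < kappa by rewrite divr_gt0 ?subr_gt0.
have k1 : kappa <= 1.
  rewrite ler_pdivrMr// mul1r; apply: (@le_trans _ _ 1); first by lra.
  by rewrite -natrM ler1n muln_gt0.
exists (4 * L.+1%:R ^+ 2 + 2 * L.+1%:R - log2 kappa) => E E0 nE Elt.
(* Below [theta] the Chernoff parameter is at most 1/2 and [M = 1] is admissible in
   [digit_count]. *)
pose theta : R := Num.min (1 / 4) ((kappa / 2 ^+ L.+2) ^+ 2).
have theta0 : 0 < theta by rewrite lt_min divr_gt0//= exprn_gt0// divr_gt0// exprn_gt0.
(* For [n >= 2 ^ k] the bound [1 / (delta * log2 n)] on [E n] is at most [theta]. *)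
pose k := (Num.truncn (1 / (delta * theta))).+1.
have kP : 1 / (delta * theta) <= k%:R by apply/ltW; rewrite truncnS_gt.
have nE1 : \forall n \near \oo, 1 <= n%:R * E n by move/cvgryPge : nE; exact.
near=> n.
have n2k : (2 ^ k <= n)%N by near: n; exact: nbhs_infty_ge.
have n2 : (2 <= n)%N by apply: leq_trans n2k; rewrite expnS leq_pmulr// expn_gt0.
have n0 : (0 < n)%N by exact: ltnW.
have e0 : 0 < E n by exact: E0.
have ne : 1 <= n%:R * E n by near: n.
have lk : k%:R <= log2 (n%:R : R).
  have := log2X k (ltr0Sn R 1); rewrite log2_2 mulr1 => <-.
  apply: ler_log2; first by rewrite exprn_gt0.
  by rewrite -natrX ler_nat.
have ln0 : 0 < log2 (n%:R : R) by apply: lt_le_trans lk; rewrite ltr0n.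
have dl0 : 0 < delta * log2 (n%:R : R) by rewrite mulr_gt0.
have en := Elt n n2.
have etheta : E n <= theta.
  apply/ltW/(lt_le_trans en); rewrite ler_pdivrMr//.
  move: kP; rewrite ler_pdivrMr ?mulr_gt0// => /le_trans; apply.
  have -> : theta * (delta * log2 n%:R) = log2 n%:R * (delta * theta) by ring.
  by rewrite ler_wpM2r// mulr_ge0// ltW.
have [e4 ek] : E n <= 1 / 4 /\ E n <= (kappa / 2 ^+ L.+2) ^+ 2.
  by apply/andP; rewrite -le_min.
have e1 : E n <= 1 by apply: le_trans e4 _; lra.
have q0 : 0 < Num.sqrt (E n) by rewrite sqrtr_gt0.
have [|M [M0 Mle Mge]] := @digit_count R L.+2 (Num.sqrt (E n)) kappa isT q0.
  rewrite mulrC -ler_pdivlMr ?exprn_gt0//.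
  have kk : 0 <= kappa / 2 ^+ L.+2 by rewrite divr_ge0 ?exprn_ge0 ?(ltW k0).
  by rewrite -ler_sqr ?nnegrE ?(ltW q0)// sqr_sqrtr ?(ltW e0).
have [|N [u [D [N0 code card]]]] :=
  DI_code_exists discY ab Wp n0 M0 (ltW e0) e4 (L := L).
  by move: Mle; rewrite ler_pdivlMr// => /(le_trans _); apply; rewrite le_eqVlt; apply/orP; left; apply/eqP; ring.
exists N, u, D; split => //.
  have ne0 : 0 <= n%:R * E n by apply: le_trans ne.
  apply: le_DI_code code; last exact: expR_le_powR2.
  by rewrite ler_wpM2l// expR_le_powR2.
apply: le_trans (rate_bound n0 N0 M0 e0 e1 ne k0 k1 Mle Mge card).
rewrite lerD2r ler_wpM2l//.
  by rewrite divr_ge0// subr_ge0 ler_pdivrMr// mul1r ler_nat.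
(* Dropping [delta * log2 n] only raises the logarithm; the upper bound on [E n] makes the smaller
   argument positive. *)
apply: ler_log2; last by rewrite lerBlDr lerDl ltW.
by rewrite subr_gt0 ltr_pdivlMr// mulrC -ltr_pdivlMr.
Unshelve. all: by end_near.
Qed.
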